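(* Every compact subset of a hereditarily normal topological group is metrizable.
   Context: All spaces are assumed to be $T_1$. *)

(* Defs.v *)
From Stdlib Require Import Reals List.
Open Scope R_scope.

Record Topology (X : Type) := {
  is_open : (X -> Prop) -> Prop;
  open_full : is_open (fun _ => True);
  open_inter : forall U V, is_open U -> is_open V -> is_open (fun x => U x /\ V x);
  open_union : forall F : (X -> Prop) -> Prop,
      (forall U, F U -> is_open U) -> is_open (fun x => exists U, F U /\ U x)
}.
Arguments is_open {X} t U.

Definition is_closed {X} (T : Topology X) (C : X -> Prop) : Prop :=
  is_open T (fun x => ~ C x).

Definition T1_space {X} (T : Topology X) : Prop :=
  forall a : X, is_closed T (fun x => x = a).

Definition normal_space {X} (T : Topology X) : Prop :=
  forall C D : X -> Prop, is_closed T C -> is_closed T D ->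
    (forall x, C x -> D x -> False) ->
    exists U V, is_open T U /\ is_open T V /\
      (forall x, C x -> U x) /\ (forall x, D x -> V x) /\
      (forall x, U x -> V x -> False).

Definition sub_open {X} (T : Topology X) (A : X -> Prop) (W : {x | A x} -> Prop) : Prop :=
  exists U, is_open T U /\ forall p : {x | A x}, W p <-> U (proj1_sig p).

Lemma sub_open_full {X} (T : Topology X) (A : X -> Prop) :
  sub_open T A (fun _ => True).
Proof. exists (fun _ => True); split; [apply open_full | tauto]. Qed.

Lemma sub_open_inter {X} (T : Topology X) (A : X -> Prop) U V :
  sub_open T A U -> sub_open T A V -> sub_open T A (fun x => U x /\ V x).
Proof.
  intros [U' [HU HU']] [V' [HV HV']].
  exists (fun x => U' x /\ V' x); split; [apply open_inter; auto|].
  intros p; rewrite HU', HV'; tauto.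
Qed.

Lemma sub_open_union {X} (T : Topology X) (A : X -> Prop)
  (F : ({x | A x} -> Prop) -> Prop) :
  (forall U, F U -> sub_open T A U) -> sub_open T A (fun x => exists U, F U /\ U x).
Proof.
  intros HF.
  exists (fun x => exists U', (is_open T U' /\ exists W, F W /\
              forall p : {x | A x}, W p <-> U' (proj1_sig p)) /\ U' x).
  split.
  - apply open_union. intros U' [H _]; exact H.
  - intros p; split.
    + intros [W [HW Wp]]. destruct (HF W HW) as [U' [HU' HU'']].
      exists U'; split; [split; [exact HU'| exists W; auto] | apply HU''; exact Wp].
    + intros [U' [[_ [W [HW HWU]]] HU']]. exists W; split; [exact HW| apply HWU; exact HU'].
Qed.

Definition subspace {X} (T : Topology X) (A : X -> Prop) : Topology {x | A x} :=
  {| is_open := sub_open T A;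
     open_full := sub_open_full T A;
     open_inter := sub_open_inter T A;
     open_union := sub_open_union T A |}.

Definition hereditarily_normal {X} (T : Topology X) : Prop :=
  forall A : X -> Prop, normal_space (subspace T A).

Definition compact_subset {X} (T : Topology X) (K : X -> Prop) : Prop :=
  forall F : (X -> Prop) -> Prop,
    (forall U, F U -> is_open T U) ->
    (forall x, K x -> exists U, F U /\ U x) ->
    exists l : list (X -> Prop),
      (forall U, In U l -> F U) /\ (forall x, K x -> exists U, In U l /\ U x).

Definition is_metric {X} (d : X -> X -> R) : Prop :=
  (forall x y, 0 <= d x y) /\
  (forall x y, d x y = 0 <-> x = y) /\
  (forall x y, d x y = d y x) /\
  (forall x y z, d x z <= d x y + d y z).

Definition metric_open {X} (d : X -> X -> R) (U : X -> Prop) : Prop :=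
  forall x, U x -> exists eps, 0 < eps /\ forall y, d x y < eps -> U y.

Definition metrizable {X} (T : Topology X) : Prop :=
  exists d : X -> X -> R, is_metric d /\
    forall U, is_open T U <-> metric_open d U.

Definition is_group {G} (mul : G -> G -> G) (inv : G -> G) (e : G) : Prop :=
  (forall x y z, mul x (mul y z) = mul (mul x y) z) /\
  (forall x, mul e x = x) /\ (forall x, mul x e = x) /\
  (forall x, mul (inv x) x = e) /\ (forall x, mul x (inv x) = e).

(* multiplication continuous G x G -> G (product topology, written out pointwise)
   and inversion continuous *)
Definition topological_group {G} (T : Topology G) (mul : G -> G -> G) (inv : G -> G) : Prop :=
  (forall x y W, is_open T W -> W (mul x y) ->
     exists U V, is_open T U /\ is_open T V /\ U x /\ V y /\
       forall a b, U a -> V b -> W (mul a b)) /\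
  (forall W, is_open T W -> is_open T (fun x => W (inv x))).

(* Main.v *)
(* A sequence x_n in an infinite compact set can be arranged to converge modulo
   the intersection N of countably many neighbourhoods of e, with the x_n in
   distinct cosets of N.  Translating the odd terms so that they share a
   cluster point with the even terms, one gets two sequences whose closures meet
   in a nonempty compact set F that contains no term of either.  Normality of
   G \ F, used as in Katetov's theorem on products, gives a G_delta subgroup H
   with F H = F; so H is compact.  An infinite compact group contains a
   nontrivial convergent sequence: by Zorn's lemma, lift a sequence converging
   modulo a closed subgroup to smaller and smaller closed subgroups.  For such
   a sequence F is a point, and the same argument shows that e is a G_delta.
   A Birkhoff-Kakutani norm then gives a continuous metric on G, which induces
   the topology of every compact subset. *)
Require Import Defs.
From Stdlib Require Import Reals List Lia Lra.
From Stdlib Require Import Classical ClassicalChoice ProofIrrelevance.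
From Stdlib Require Import FunctionalExtensionality PropExtensionality.
From Stdlib Require Import ssreflect ssrbool.
From Stdlib Require Cantor.
From mathcomp Require boolp classical_sets.

(** * Open sets, closures and compactness in an arbitrary space *)

Section Topology.

Context {X : Type} (T : Topology X).

Lemma open_ext (U V : X -> Prop) :
  (forall x, U x <-> V x) -> is_open T U -> is_open T V.
Proof.
  move=> UV.
  have -> : V = U; last by [].
  by apply: functional_extensionality => x; apply: propositional_extensionality; split=> /UV.
Qed.

Lemma open_of_nbhds (U : X -> Prop) :
  (forall x, U x -> exists O, is_open T O /\ O x /\ forall y, O y -> U y) ->
  is_open T U.
Proof.
  move=> HU.
  apply: (open_ext (fun x => exists O, (is_open T O /\ forall y, O y -> U y) /\ O x)).
  - move=> x; split; first by move=> [O [[_ OU] Ox]]; exact: OU.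
    by move=> /HU [O [HO [Ox OU]]]; exists O.
  - by apply: open_union => O [].
Qed.

Lemma open_or (U V : X -> Prop) :
  is_open T U -> is_open T V -> is_open T (fun x => U x \/ V x).
Proof.
  move=> HU HV; apply: open_of_nbhds => x [Ux|Vx].
  - by exists U; split=> //; split=> // y; left.
  - by exists V; split=> //; split=> // y; right.
Qed.

Lemma open_const (P : Prop) : is_open T (fun _ => P).
Proof.
  apply: open_of_nbhds => x p; exists (fun _ => True).
  by split; first exact: open_full.
Qed.

Lemma open_neq (HT1 : T1_space T) (a : X) : is_open T (fun x => x <> a).
Proof. exact: HT1. Qed.

(** Allows finitely many terms of a sequence to be removed from a neighbourhood, as [closure_range]
    requires. *)
Lemma open_neq_below (HT1 : T1_space T) (a : nat -> X) (m : nat) :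
  is_open T (fun x => forall n, n < m -> x <> a n)%nat.
Proof.
  elim: m => [|m IH].
  - apply: (open_ext (fun _ => True)); last exact: open_full.
    by move=> x; split=> // _ n; lia.
  - apply: (open_ext (fun x => (forall n, (n < m)%nat -> x <> a n) /\ x <> a m));
      last by apply: open_inter => //; exact: open_neq.
    move=> x; split.
    + move=> [Hlt Hm] n Hn; have [->|Hn'] : n = m \/ (n < m)%nat by lia.
      * exact: Hm.
      * exact: Hlt.
    + by move=> H; split=> [n Hn|]; apply: H; lia.
Qed.

Definition closure (A : X -> Prop) (x : X) : Prop :=
  forall U, is_open T U -> U x -> exists y, U y /\ A y.

Lemma closure_incl (A : X -> Prop) (x : X) : A x -> closure A x.
Proof. by move=> Ax U _ Ux; exists x. Qed.

Lemma closure_closed (A : X -> Prop) : is_closed T (closure A).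
Proof.
  apply: open_of_nbhds => x Hx.
  have [U HU] := not_all_ex_not _ _ Hx.
  have [HO {}HU] := imply_to_and _ _ HU.
  have [Ux {}HU] := imply_to_and _ _ HU.
  exists U; split=> //; split=> // y Uy Hy; apply: HU; exact: Hy.
Qed.

Lemma closure_min (A C : X -> Prop) (x : X) :
  is_closed T C -> (forall y, A y -> C y) -> closure A x -> C x.
Proof.
  move=> HC AC Hx; apply: NNPP => nCx.
  by have [y [nCy /AC]] := Hx _ HC nCx.
Qed.

(* Compactness as a local-to-global principle for ideals of sets. *)
Lemma compact_ind (K : X -> Prop) (P : (X -> Prop) -> Prop) :
  compact_subset T K ->
  P (fun _ => False) ->
  (forall S S' : X -> Prop, (forall x, S x -> S' x) -> P S' -> P S) ->
  (forall S S', P S -> P S' -> P (fun x => S x \/ S' x)) ->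
  (forall x, K x -> exists U, is_open T U /\ U x /\ P U) ->
  P K.
Proof.
  move=> HK P0 Pmono Pcup Ploc.
  have [||l [lP lK]] := HK (fun U => is_open T U /\ P U).
  - by move=> U [].
  - by move=> x /Ploc [U [HU [Ux PU]]]; exists U.
  - apply: (Pmono _ (fun x => exists U, In U l /\ U x)); first exact: lK.
    elim: l lP {lK} => [|U l IH] lP.
    + by apply: Pmono P0 => x [U []].
    + apply: (Pmono _ (fun x => U x \/ exists V, In V l /\ V x)).
        by move=> x [V [[->|Vl] Vx]]; [left|right; exists V].
      apply: Pcup; first by case: (lP U (or_introl eq_refl)).
      by apply: IH => V Vl; apply: lP; right.
Qed.

Lemma compact_closed_subset (K C : X -> Prop) :
  compact_subset T K -> is_closed T C -> (forall x, C x -> K x) ->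
  compact_subset T C.
Proof.
  move=> HK HC CK F Fo Fc.
  (* Only the part of [S] inside [C] has to be covered, so the empty list works on the complement of
     [C]. *)
  pose P (S : X -> Prop) := exists l, (forall U, In U l -> F U) /\
    (forall x, S x -> C x -> exists U, In U l /\ U x).
  have [] : P K; last first.
  - by move=> l [lF lC]; exists l; split=> // x Cx; apply: lC => //; exact: CK.
  - apply: compact_ind => //.
    + by exists nil.
    + by move=> S S' SS' [l [lF lC]]; exists l; split=> // x /SS'; exact: lC.
    + move=> S S' [l [lF lC]] [l' [lF' lC']]; exists (l ++ l'); split.
        by move=> U /in_app_iff []; [exact: lF|exact: lF'].
      move=> x [/lC H|/lC' H] Cx; have [U [Ul Ux]] := H Cx; exists U;
        by rewrite in_app_iff; tauto.
    + move=> x Kx; have [/Fc [U [FU Ux]]|nCx] := classic (C x).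
        exists U; split; [exact: Fo|split=> //]; exists (U :: nil); split.
          by move=> V [<-|[]].
        by move=> y Uy _; exists U; split=> //; left.
      exists (fun y => ~ C y); split=> //; split=> //.
      by exists nil.
Qed.

Lemma compact_image (K : X -> Prop) (f : X -> X) :
  compact_subset T K ->
  (forall U, is_open T U -> is_open T (fun x => U (f x))) ->
  compact_subset T (fun y => exists x, K x /\ f x = y).
Proof.
  move=> HK Hf F Fo Fc.
  pose P (S : X -> Prop) := exists l, (forall U, In U l -> F U) /\
    (forall x, S x -> exists U, In U l /\ U (f x)).
  have [] : P K; last first.
  - move=> l [lF lC]; exists l; split=> // y [x [Kx <-]]; exact: lC.
  - apply: compact_ind => //.
    + by exists nil.
    + by move=> S S' SS' [l [lF lC]]; exists l; split=> // x /SS'; exact: lC.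
    + move=> S S' [l [lF lC]] [l' [lF' lC']]; exists (l ++ l'); split.
        by move=> U /in_app_iff []; [exact: lF|exact: lF'].
      move=> x [/lC H|/lC' H]; have [U [Ul Ux]] := H; exists U;
        by rewrite in_app_iff; tauto.
    + move=> x Kx; have [|U [FU Ux]] := Fc (f x); first by exists x.
      exists (fun y => U (f y)); split; [apply: Hf; exact: Fo|split=> //].
      exists (U :: nil); split.
        by move=> V [<-|[]].
      by move=> y Uy; exists U; split=> //; left.
Qed.

(** The sets that the sequence eventually avoids form an ideal. Without a cluster point, [K] would
    belong to it locally, hence globally, although every term lies in [K]. *)
Lemma compact_cluster (K : X -> Prop) (a : nat -> X) :
  compact_subset T K -> (forall n, K (a n)) ->
  exists p, K p /\ forall U, is_open T U -> U p ->
    forall n, exists m, (n <= m)%nat /\ U (a m).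
Proof.
  move=> HK Ka; apply: NNPP => Hno.
  pose P (S : X -> Prop) := exists n, forall m, (n <= m)%nat -> ~ S (a m).
  have [] : P K; last by move=> n /(_ n (Nat.le_refl n)) [].
  apply: compact_ind => //.
  - by exists 0%nat => m _ [].
  - by move=> S S' SS' [n Hn]; exists n => m /Hn nS /SS'.
  - move=> S S' [n Hn] [n' Hn']; exists (n + n')%nat => m Hm.
    by case; [apply: Hn|apply: Hn']; lia.
  - move=> x Kx; apply: NNPP => HU; apply: Hno; exists x; split=> // U Uo Ux n.
    apply: NNPP => Hn; apply: HU; exists U; split=> //; split=> //.
    by exists n => m Hm Um; apply: Hn; exists m.
Qed.

End Topology.

Lemma infinite_injection {X : Type} (K : X -> Prop) :
  ~ (exists l, forall x, K x -> In x l) ->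
  exists a : nat -> X, (forall n, K (a n)) /\
    forall n m, a n = a m -> n = m.
Proof.
  move=> Hinf.
  have [f Hf] : exists f : list X -> X, forall l, K (f l) /\ ~ In (f l) l.
    apply: (choice (fun l x => K x /\ ~ In x l)) => l; apply: NNPP => Hno.
    apply: Hinf; exists l => x Kx; apply: NNPP => nl; apply: Hno.
    by exists x.
  (* [L n] lists the first [n] chosen points, and [f] picks the next point outside this list. *)
  pose L := nat_rect (fun _ => list X) nil (fun _ l => f l :: l).
  have HL m n : (n < m)%nat -> In (f (L n)) (L m).
    elim: m => [|m IH] Hn; first by lia.
    have [->|Hn'] : n = m \/ (n < m)%nat by lia.
      by left.
    by right; exact: IH.
  exists (fun n => f (L n)); split=> [n|n m Hnm]; first exact: (proj1 (Hf _)).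
  have [Hlt|[//|Hlt]] : (n < m \/ n = m \/ m < n)%nat by lia.
  - by case: (proj2 (Hf (L m))); rewrite -Hnm; exact: HL.
  - by case: (proj2 (Hf (L n))); rewrite Hnm; exact: HL.
Qed.

(** * Words over the natural numbers and their dyadic weights *)

Fixpoint weight (s : list nat) : R :=
  match s with
  | nil => 0
  | k :: s' => (/ 2) ^ k + weight s'
  end.

Lemma half_pow_gt0 k : 0 < (/ 2) ^ k.
Proof. by apply: pow_lt; lra. Qed.

Lemma half_pow_le m n : (m <= n)%nat -> (/ 2) ^ n <= (/ 2) ^ m.
Proof.
  elim: n => [|n IH] Hmn; first by (have -> : m = 0%nat by lia); lra.
  have [->|Hmn'] : m = S n \/ (m <= n)%nat by lia.
    by lra.
  by have := IH Hmn'; have := half_pow_gt0 n; simpl; lra.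
Qed.

Lemma weight_ge0 s : 0 <= weight s.
Proof. by elim: s => [|k s IH] /=; [lra|have := half_pow_gt0 k; lra]. Qed.

Lemma weight_app s t : weight (s ++ t) = weight s + weight t.
Proof. by elim: s => [|k s IH] /=; [lra|rewrite IH; lra]. Qed.

Lemma weight_rev s : weight (rev s) = weight s.
Proof. by elim: s => [|k s IH] //=; rewrite weight_app IH /=; lra. Qed.

(** The letter [k] is the one at which the running weight first exceeds [t]. *)
Lemma weight_split s t : 0 <= t -> t < weight s ->
  exists l k r, s = l ++ k :: r /\ weight l <= t /\ t < weight l + (/ 2) ^ k.
Proof.
  elim: s t => [|k s IH] t Ht /= Hs; first by lra.
  have [Hk|Hk] := Rlt_le_dec t ((/ 2) ^ k).
    by exists nil, k, s; split=> //=; lra.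
  have [||l [j [r [-> [Hl Hr]]]]] := IH (t - (/ 2) ^ k); try lra.
  by exists (k :: l), j, r; split=> //=; lra.
Qed.

(** * Group algebra and continuity of translations *)

Section TopologicalGroup.

Context {G : Type} (T : Topology G) (mul : G -> G -> G) (inv : G -> G) (e : G).
Context (Hgrp : is_group mul inv e) (Htop : topological_group T mul inv).
Context (HT1 : T1_space T).

Local Notation "x ** y" := (mul x y) (at level 40, left associativity).

Lemma mulA x y z : x ** (y ** z) = x ** y ** z.
Proof. by case: Hgrp. Qed.
Lemma mul1g x : e ** x = x.
Proof. by case: Hgrp => _ []. Qed.
Lemma mulg1 x : x ** e = x.
Proof. by case: Hgrp => _ [_ []]. Qed.
Lemma mulVg x : inv x ** x = e.
Proof. by case: Hgrp => _ [_ [_ []]]. Qed.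
Lemma mulgV x : x ** inv x = e.
Proof. by case: Hgrp => _ [_ [_ []]]. Qed.
Lemma mulgK x y : x ** y ** inv y = x.
Proof. by rewrite -mulA mulgV mulg1. Qed.
Lemma mulgKV x y : x ** inv y ** y = x.
Proof. by rewrite -mulA mulVg mulg1. Qed.
Lemma inv_unique x y : x ** y = e -> y = inv x.
Proof. by move=> H; rewrite -[y]mul1g -(mulVg x) -mulA H mulg1. Qed.
Lemma invM x y : inv (x ** y) = inv y ** inv x.
Proof. by symmetry; apply: inv_unique; rewrite mulA mulgK mulgV. Qed.
Lemma invK x : inv (inv x) = x.
Proof. by symmetry; apply: inv_unique; rewrite mulVg. Qed.
Lemma inv1 : inv e = e.
Proof. by symmetry; apply: inv_unique; rewrite mulg1. Qed.
Lemma eq_of_mulV x y : inv x ** y = e -> x = y.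
Proof. by move=> /inv_unique ->; rewrite invK. Qed.

Local Ltac gsimp :=
  rewrite ?(invM, invK, inv1, mulA, mulgK, mulgKV, mul1g, mulg1, mulVg, mulgV).

Lemma open_mull a W : is_open T W -> is_open T (fun x => W (a ** x)).
Proof.
  move=> HW; apply: open_of_nbhds => x Wx.
  have [U [V [_ [HV [Ua [Vx HUV]]]]]] := proj1 Htop _ _ _ HW Wx.
  by exists V; split=> //; split=> // y Vy; apply: HUV.
Qed.

Lemma open_mulr a W : is_open T W -> is_open T (fun x => W (x ** a)).
Proof.
  move=> HW; apply: open_of_nbhds => x Wx.
  have [U [V [HU [_ [Ua [Vx HUV]]]]]] := proj1 Htop _ _ _ HW Wx.
  by exists U; split=> //; split=> // y Vy; apply: HUV.
Qed.

Lemma open_inv W : is_open T W -> is_open T (fun x => W (inv x)).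
Proof. by case: Htop => _; apply. Qed.

(** * Chains of neighbourhoods of the identity and their cores *)

Definition chain (V : nat -> G -> Prop) : Prop :=
  (forall n, is_open T (V n)) /\ (forall n, V n e) /\
  (forall n x, V n x -> V n (inv x)) /\
  (forall n x y, V (S n) x -> V (S n) y -> V n (x ** y)).

(** For a chain this is a closed G_delta subgroup, in general not normal. Hence only left cosets are
    used, [x] and [y] being congruent when [inv x ** y] is in the core. *)
Definition core (V : nat -> G -> Prop) (x : G) : Prop := forall n, V n x.

Lemma chain_le V : chain V -> forall m n x, (m <= n)%nat -> V n x -> V m x.
Proof.
  move=> [_ [V1 [_ VM]]] m n x; elim: n => [|n IH] Hmn Vx.
  - by have -> : m = 0%nat by lia.
  - have [->//|Hmn'] : m = S n \/ (m <= n)%nat by lia.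
    by apply: IH => //; rewrite -(mulg1 x); apply: VM.
Qed.

Lemma coreM V x y : chain V -> core V x -> core V y -> core V (x ** y).
Proof. by move=> [_ [_ [_ VM]]] Vx Vy n; apply: VM. Qed.

Lemma coreV V x : chain V -> core V x -> core V (inv x).
Proof. by move=> [_ [_ [VV _]]] Vx n; apply: VV. Qed.

Lemma core1 V : chain V -> core V e.
Proof. by move=> [_ [V1 _]] n. Qed.

Lemma square_root_nbhd W : is_open T W -> W e ->
  exists V, is_open T V /\ V e /\ (forall x, V x -> V (inv x)) /\
    (forall x y, V x -> V y -> W (x ** y)).
Proof.
  move=> HW We; have Wee : W (e ** e) by rewrite mulg1.
  have [U [V [HU [HV [Ue [Ve HUV]]]]]] := proj1 Htop _ _ _ HW Wee.
  exists (fun x => (U x /\ V x) /\ (U (inv x) /\ V (inv x))); split.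
    by apply: open_inter; [|apply: (open_inv (fun x => U x /\ V x))]; apply: open_inter.
  split; first by rewrite inv1.
  split; first by move=> x; rewrite invK; tauto.
  by move=> x y [[Ux _] _] [[_ Vy] _]; apply: HUV.
Qed.

(** Each new term is a symmetric square root of the previous term cut down by the next [W]. In this
    way countably many neighbourhoods of [e] are made to contain one core. *)
Lemma chain_refine (W : nat -> G -> Prop) :
  (forall n, is_open T (W n)) -> (forall n, W n e) ->
  exists V, chain V /\ forall n x, V n x -> W n x.
Proof.
  move=> HW We.
  (* [r] must be total; away from open neighbourhoods of [e] the argument itself serves as a
     default. *)
  have [r Hr] : exists r : (G -> Prop) -> G -> Prop, forall U, is_open T U /\ U e ->
      is_open T (r U) /\ r U e /\ (forall x, r U x -> r U (inv x)) /\
      (forall x y, r U x -> r U y -> U (x ** y)).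
    apply: (choice (fun U V => is_open T U /\ U e ->
      is_open T V /\ V e /\ (forall x, V x -> V (inv x)) /\
      (forall x y, V x -> V y -> U (x ** y)))) => U.
    have [[HU Ue]|nU] := classic (is_open T U /\ U e).
      by have [V HV] := square_root_nbhd U HU Ue; exists V.
    by exists U.
  pose V := nat_rect (fun _ => G -> Prop) (r (W 0%nat))
    (fun n U => r (fun x => U x /\ W (S n) x)).
  have good n : is_open T (V n) /\ V n e.
    elim: n => [|n [IHo IHe]]; first by have [? []] := Hr _ (conj (HW 0%nat) (We 0%nat)).
    have [|? [? _]] := Hr (fun x => V n x /\ W (S n) x); last by split.
    by split; [apply: open_inter|].
  have goodS n : is_open T (fun x => V n x /\ W (S n) x) /\ (V n e /\ W (S n) e).
    have [? ?] := good n; split; last by split.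
    by apply: open_inter.
  exists V; split.
  - split; first by move=> n; case: (good n).
    split; first by move=> n; case: (good n).
    split.
      move=> [|n] x.
        by have [_ [_ [H _]]] := Hr _ (conj (HW 0%nat) (We 0%nat)); exact: H.
      by have [_ [_ [H _]]] := Hr _ (goodS n); exact: H.
    move=> n x y Vx Vy; have [_ [_ [_ H]]] := Hr _ (goodS n).
    by case: (H x y Vx Vy).
  - move=> [|n] x Vx; rewrite -(mulg1 x).
      have [_ [H1 [_ H]]] := Hr _ (conj (HW 0%nat) (We 0%nat)).
      exact: H.
    have [_ [H1 [_ H]]] := Hr _ (goodS n).
    by case: (H _ _ Vx H1).
Qed.

Lemma chain_inter V V' : chain V -> chain V' ->
  exists U, chain U /\ (forall n x, U n x -> V n x /\ V' n x).
Proof.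
  move=> [Vo [V1 _]] [Vo' [V1' _]].
  apply: (chain_refine (fun n x => V n x /\ V' n x)) => n //.
  exact: open_inter.
Qed.

(** When [a i <> a j], the quotient [inv (a i) ** a j] differs from [e], so by T1 one neighbourhood
    of [e] excludes it. The Cantor pairing enumerates these conditions. *)
Lemma chain_separating (a : nat -> G) :
  exists V, chain V /\ forall i j, core V (inv (a i) ** a j) -> a i = a j.
Proof.
  pose W n g := let (i, j) := Cantor.of_nat n in a i <> a j -> g <> inv (a i) ** a j.
  have [||V [HV VW]] := chain_refine W.
  - move=> n; rewrite /W; case: (Cantor.of_nat n) => i j.
    have [E|E] := classic (a i = a j).
      by apply: (open_ext _ (fun _ => True)); [tauto|exact: open_full].
    apply: (open_ext _ (fun g => g <> inv (a i) ** a j)); first by tauto.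
    exact: HT1.
  - move=> n; rewrite /W; case: (Cantor.of_nat n) => i j nE E.
    by apply: nE; apply: eq_of_mulV.
  - exists V; split=> // i j H; apply: NNPP => nE.
    have := VW (Cantor.to_nat (i, j)) _ (H _).
    by rewrite /W Cantor.cancel_of_to; apply.
Qed.

Lemma chain_separating_point g : g <> e -> exists V, chain V /\ ~ V 0%nat g.
Proof.
  move=> ge.
  have [||V [HV VW]] := chain_refine (fun _ x => x <> g).
  - by move=> _; exact: HT1.
  - by move=> _ E; apply: ge.
  - by exists V; split=> // /VW.
Qed.

(** If the translates of [V 1] to [x] and [y] met, [inv x ** y] would be a product of two elements
    of [V 1] and so lie in [V 0]. *)
Lemma hausdorff x y : x <> y ->
  exists U V, is_open T U /\ is_open T V /\ U x /\ V y /\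
    forall z, U z -> V z -> False.
Proof.
  move=> xy; have [|V [HV Vg]] := chain_separating_point (inv x ** y).
    by move=> /eq_of_mulV.
  case: (HV) => [Vo [V1 [VV VM]]].
  exists (fun z => V 1%nat (inv x ** z)), (fun z => V 1%nat (inv y ** z)).
  split; first exact: open_mull.
  split; first exact: open_mull.
  rewrite !mulVg; split=> //; split=> // z /VM H /VV /H; gsimp => H'.
  exact: Vg.
Qed.

Lemma compact_closed K : compact_subset T K -> is_closed T K.
Proof.
  move=> HK; apply: open_of_nbhds => x nKx.
  pose P (S : G -> Prop) := exists O, is_open T O /\ O x /\ forall y, O y -> ~ S y.
  apply: (compact_ind T K P HK).
  - by exists (fun _ => True); split; [exact: open_full|split=> // y _ []].
  - move=> S S' SS' [O [HO [Ox H]]]; exists O; split=> //; split=> // y /H nS /SS'.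
    exact: nS.
  - move=> S S' [O [HO [Ox H]]] [O' [HO' [Ox' H']]].
    exists (fun z => O z /\ O' z); split; first exact: open_inter.
    split=> // y [Oy Oy'] [Sy|Sy]; [exact: (H y)|exact: (H' y)].
  - move=> y Ky; have [|U [V [HU [HV [Ux [Vy HUV]]]]]] := hausdorff x y.
      by move=> E; apply: nKx; rewrite E.
    exists V; split=> //; split=> //; exists U; split=> //; split=> // z Uz Vz.
Qed.

(** Stronger than closedness of the core: a single index [k] serves a whole neighbourhood of [f].
    That is what makes sequences converging to the core avoid this neighbourhood eventually. *)
Lemma core_avoid V f : chain V -> ~ core V f ->
  exists k O, is_open T O /\ O f /\ forall y, O y -> ~ V k y.
Proof.
  move=> [Vo [V1 [VV VM]]] /not_all_ex_not [k nVk].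
  exists (S k), (fun y => V (S k) (inv f ** y)); split; first exact: open_mull.
  rewrite mulVg; split=> // y /VV H Vy; apply: nVk.
  by have := VM _ _ _ Vy H; gsimp.
Qed.

Lemma core_closed V : chain V -> is_closed T (core V).
Proof.
  move=> HV; apply: open_of_nbhds => x /(core_avoid V x HV) [k [O [HO [Ox H]]]].
  by exists O; split=> //; split=> // y /H nV /(_ k).
Qed.

(** If [f] were not a term, deleting the first [m] terms from [O] would leave a neighbourhood of [f]
    disjoint from the sequence. *)
Lemma closure_range (a : nat -> G) f :
  closure T (fun x => exists n, a n = x) f ->
  (exists O m, is_open T O /\ O f /\ forall n, (m <= n)%nat -> ~ O (a n)) ->
  exists n, a n = f.
Proof.
  move=> Hf [O [m [HO [Of Oa]]]]; apply: NNPP => Hno.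
  have [|| y [[Oy Hy] [n Hn]]] :=
    Hf (fun x => O x /\ forall n, (n < m)%nat -> x <> a n).
  - by apply: open_inter => //; exact: open_neq_below.
  - by split=> // n _ E; apply: Hno; exists n.
  - have [Hm|Hm] : (m <= n \/ n < m)%nat by lia.
      by apply: (Oa n Hm); rewrite Hn.
    by apply: (Hy n Hm).
Qed.

Lemma cluster_in_core V (a : nat -> G) p : chain V ->
  (forall k, exists m, forall n, (m <= n)%nat -> V k (a n)) ->
  (forall U, is_open T U -> U p -> forall n, exists m, (n <= m)%nat /\ U (a m)) ->
  core V p.
Proof.
  move=> HV Ha Hp; apply: NNPP => /(core_avoid V p HV) [k [O [HO [Op H]]]].
  have [m Hm] := Ha k; have [n [Hn On]] := Hp O HO Op m.
  by apply: (H _ On); exact: Hm.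
Qed.

Lemma closure_to_core V (a : nat -> G) f : chain V ->
  (forall k, exists m, forall n, (m <= n)%nat -> V k (a n)) ->
  closure T (fun x => exists n, a n = x) f -> ~ core V f ->
  exists n, a n = f.
Proof.
  move=> HV Ha Hf /(core_avoid V f HV) [k [O [HO [Of H]]]].
  apply: closure_range => //; have [m Hm] := Ha k.
  exists O, m; split=> //; split=> // n /Hm Vn /H; exact.
Qed.

(** The terms are separated modulo a core and then thinned out so that they approach a cluster point
    [p] modulo that core. Translating by [inv p] gives a sequence that converges to the core without
    meeting it. *)
Lemma spread_sequence K (a : nat -> G) :
  compact_subset T K -> (forall n, K (a n)) -> (forall n m, a n = a m -> n = m) ->
  exists V p (x : nat -> G), chain V /\ K p /\ (forall n, K (p ** x n)) /\
    (forall n, V n (x n)) /\ (forall n, ~ core V (x n)) /\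
    (forall n m, core V (inv (x n) ** x m) -> n = m).
Proof.
  move=> HK Ka inj.
  have [V [HV Vsep]] := chain_separating a.
  have [p [Kp Hp]] := compact_cluster T K a HK Ka.
  case: (HV) => [Vo [V1 [VV VM]]].
  (* The terms lie in distinct cosets, so at most one lies in the coset of [p]; the selection starts
     after it. *)
  have [n0 Hn0] : exists n0, forall i, (n0 <= i)%nat -> ~ core V (inv p ** a i).
    have [[i0 Hi0]|Hno] := classic (exists i, core V (inv p ** a i)); last first.
      by exists 0%nat => i _ H; apply: Hno; exists i.
    exists (S i0) => i Hi H.
    have := coreM V _ _ HV (coreV V _ HV Hi0) H; gsimp => /Vsep /inj E.
    by lia.
  have [s Hs] : exists s : nat * nat -> nat, forall q,
      (snd q <= s q)%nat /\ V (fst q) (inv p ** a (s q)).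
    apply: (choice (fun (q : nat * nat) m => (snd q <= m)%nat /\
      V (fst q) (inv p ** a m))) => -[k n] /=.
    apply: (Hp (fun x => V k (inv p ** x))); first exact: open_mull.
    by rewrite mulVg.
  (* [s (k, n)] is an index from [n] on whose term is [V k]-close to [p], so [t] increases strictly
     and its [n]-th term is [V n]-close. *)
  pose t := nat_rect (fun _ => nat) (s (0%nat, n0)) (fun n i => s (S n, S i)).
  have tS n : (t n < t (S n))%nat by have [/= ? _] := Hs (S n, S (t n)).
  have t0 n : (n0 <= t n)%nat.
    elim: n => [|n IH]; first by have [/= ? _] := Hs (0%nat, n0).
    by have := tS n; lia.
  have tlt n m : (n < m)%nat -> (t n < t m)%nat.
    elim: m => [|m IH] Hm; first by lia.
    have := tS m; have [->//|Hm'] : n = m \/ (n < m)%nat by lia.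
    by have := IH Hm'; lia.
  exists V, p, (fun n => inv p ** a (t n)); split=> //; split=> //.
  split; first by move=> n; gsimp.
  split; first by case=> [|n]; [have [_ ?] := Hs (0%nat, n0)|have [_ ?] := Hs (S n, S (t n))].
  split; first by move=> n; apply: Hn0; exact: t0.
  move=> n m; gsimp => /Vsep /inj E.
  have [/tlt H|[//|/tlt H]] : (n < m \/ n = m \/ m < n)%nat by lia.
  - by lia.
  - by lia.
Qed.

(** * Hereditary normality and stabilizers *)

(** Normality is applied to the complement of the intersection of [C] and [D], where their traces
    are disjoint. This complement is open, so its relatively open sets are open in [G]. *)
Lemma hereditarily_normal_separation (Hhn : hereditarily_normal T) C D :
  is_closed T C -> is_closed T D ->
  exists U V, is_open T U /\ is_open T V /\
    (forall x, C x -> ~ D x -> U x) /\ (forall x, D x -> ~ C x -> V x) /\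
    (forall x, U x -> V x -> False).
Proof.
  move=> HC HD; pose Z x := ~ (C x /\ D x).
  have HZ : is_open T Z.
    apply: (open_ext T (fun x => ~ C x \/ ~ D x)); last exact: open_or.
    by move=> x; rewrite /Z; tauto.
  have cl E : is_closed T E -> is_closed (subspace T Z) (fun p => E (proj1_sig p)).
    by move=> HE; exists (fun x => ~ E x).
  have [|U [V [[U' [HU' UU']] [[V' [HV' VV']] [CU [DV UV]]]]]] :=
    Hhn Z _ _ (cl _ HC) (cl _ HD).
    by move=> [x Zx] /= Cx Dx; apply: Zx.
  exists (fun x => Z x /\ U' x), (fun x => Z x /\ V' x).
  split; first exact: open_inter.
  split; first exact: open_inter.
  split.
    move=> x Cx nDx; have Zx : Z x by move=> [].
    by split=> //; apply/(UU' (exist _ x Zx)); apply: CU.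
  split.
    move=> x Dx nCx; have Zx : Z x by move=> [].
    by split=> //; apply/(VV' (exist _ x Zx)); apply: DV.
  move=> x [Zx Ux] [_ Vx]; apply: (UV (exist _ x Zx)); [exact/UU'|exact/VV'].
Qed.

(* Katetov's argument for products, with the multiplication of the group in
   place of the product. *)
Lemma common_closure_stabilizer (Hhn : hereditarily_normal T) (a b : nat -> G) :
  let F x := closure T (fun y => exists n, a n = y) x /\
             closure T (fun y => exists n, b n = y) x in
  (forall n, ~ F (a n)) -> (forall n, ~ F (b n)) ->
  exists V, chain V /\ forall f g, F f -> core V g -> F (f ** g).
Proof.
  move=> F Fa Fb.
  set A := closure T (fun y => exists n, a n = y) in F Fa Fb *.
  set B := closure T (fun y => exists n, b n = y) in F Fa Fb *.
  have HA : is_closed T A by exact: closure_closed.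
  have HB : is_closed T B by exact: closure_closed.
  have Aa n : A (a n) by apply: closure_incl; exists n.
  have Bb n : B (b n) by apply: closure_incl; exists n.
  have [O1 [O2 [HO1 [HO2 [AO [BO O12]]]]]] := hereditarily_normal_separation Hhn A B HA HB.
  have Ocl O : is_open T O -> is_closed T (fun x => ~ O x).
    by move=> HO; apply: (open_ext T O) => // x; tauto.
  (* A second separation replaces [O1] by a pair of disjoint open sets: [U1] contains the part of
     [A] in [O1], and [V1] the points outside both [A] and [O1]. Likewise for [B] and [O2]. *)
  have [U1 [V1 [HU1 [HV1 [AU1 [YV1 UV1]]]]]] :=
    hereditarily_normal_separation Hhn A _ HA (Ocl _ HO1).
  have [U2 [V2 [HU2 [HV2 [BU2 [YV2 UV2]]]]]] :=
    hereditarily_normal_separation Hhn B _ HB (Ocl _ HO2).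
  have aU n : U1 (a n).
    by apply: AU1 => // nO; apply: nO; apply: AO => // Bn; exact: (Fa n).
  have bU n : U2 (b n).
    by apply: BU2 => // nO; apply: nO; apply: BO => // An; exact: (Fb n).
  (* Translating by an element of the core then keeps every [a n] in [U1] and every [b n] in
     [U2]. *)
  have [||V [HV VW]] := chain_refine (fun n g => U1 (a n ** g) /\ U2 (b n ** g)).
  - by move=> n; apply: open_inter; exact: open_mull.
  - by move=> n; rewrite !mulg1.
  exists V; split=> // f g [Af Bf] Vg; apply: NNPP => nF.
  (* If [f ** g] is outside [O1], it lies in the open set [V1]. As [f] is in the closure of the
     [a n], some [a n ** g] lies in [V1] too, but it is in [U1]. *)
  have : ~ O1 (f ** g) \/ ~ O2 (f ** g).
    by have := O12 (f ** g); tauto.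
  case=> nO.
  - have V1f : V1 (f ** g).
      apply: YV1 => // Afg; apply: nO; apply: AO => // Bfg; exact: nF.
    have [y [Vy [n Hn]]] := Af _ (open_mulr g _ HV1) V1f.
    have [Un _] := VW n _ (Vg n).
    by apply: (UV1 (a n ** g)) => //; rewrite Hn.
  - have V2f : V2 (f ** g).
      apply: YV2 => // Bfg; apply: nO; apply: BO => // Afg; exact: nF.
    have [y [Vy [n Hn]]] := Bf _ (open_mulr g _ HV2) V2f.
    have [_ Un] := VW n _ (Vg n).
    by apply: (UV2 (b n ** g)) => //; rewrite Hn.
Qed.

Lemma compact_mull K a : compact_subset T K -> compact_subset T (fun x => K (a ** x)).
Proof.
  move=> HK.
  have HC := compact_image T K (fun x => inv a ** x) HK (fun U => open_mull _ U).
  have HaK : is_closed T (fun x => K (a ** x)).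
    by have := compact_closed K HK; exact: (open_mull a).
  apply: (compact_closed_subset T _ _ HC HaK) => x Kx.
  by exists (a ** x); split=> //; gsimp.
Qed.

Lemma compact_gdelta_subgroup (Hhn : hereditarily_normal T) K (k : nat -> G) :
  compact_subset T K -> (forall n, K (k n)) -> (forall n m, k n = k m -> n = m) ->
  exists V, chain V /\ compact_subset T (core V).
Proof.
  move=> HK Kk inj.
  have [V [p [x [HV [Kp [Kx [Vx [nVx xsep]]]]]]]] := spread_sequence K k HK Kk inj.
  have HK' := compact_mull K p HK.
  pose a n := x (2 * n)%nat.
  have [c1 [Kc1 Hc1]] := compact_cluster T _ a HK' (fun n => Kx _).
  have [c2 [Kc2 Hc2]] := compact_cluster T _ (fun n => x (2 * n + 1)%nat) HK' (fun n => Kx _).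
  have Va i : exists m, forall n, (m <= n)%nat -> V i (a n).
    by exists i => n Hn; apply: (chain_le V HV _ (2 * n)%nat); [lia|exact: Vx].
  have Vo i : exists m, forall n, (m <= n)%nat -> V i (x (2 * n + 1)%nat).
    by exists i => n Hn; apply: (chain_le V HV _ (2 * n + 1)%nat); [lia|exact: Vx].
  have Vc : core V (inv c2 ** c1).
    apply: coreM => //; last by exact: (cluster_in_core V a).
    by apply: coreV => //; exact: (cluster_in_core V _ _ HV Vo).
  (* Right translation moves the cluster point [c2] of the odd terms to [c1]. The translating
     element is in [core V], so cosets are unchanged. *)
  pose b n := x (2 * n + 1)%nat ** (inv c2 ** c1).
  have Vb i : exists m, forall n, (m <= n)%nat -> V i (b n).
    have [m Hm] := Vo (S i); exists m => n /Hm Hn.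
    by case: HV => [_ [_ [_ VM]]]; apply: VM.
  (* Off the core a common closure point would be a term of both sequences, putting an even and an
     odd term of [x] into one coset. *)
  have FV f : closure T (fun y => exists n, a n = y) f /\
      closure T (fun y => exists n, b n = y) f -> core V f.
    move=> [Af Bf]; apply: NNPP => nVf.
    have [n Hn] := closure_to_core V a f HV Va Af nVf.
    have [m Hm] := closure_to_core V b f HV Vb Bf nVf.
    have : core V (inv (x (2 * m + 1)%nat) ** x (2 * n)%nat).
      rewrite -[x (2 * n)%nat]/(a n) Hn -Hm /b mulA mulVg mul1g; exact: Vc.
    by move=> /xsep; lia.
  have [||V' [HV' HF]] := common_closure_stabilizer Hhn a b.
  - by move=> n /FV; exact: nVx.
  - move=> n /FV H; apply: (nVx (2 * n + 1)%nat).
    have := coreM V _ _ HV H (coreV V _ HV Vc).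
    by rewrite /b mulgK.
  have Fc1 : closure T (fun y => exists n, a n = y) c1 /\
      closure T (fun y => exists n, b n = y) c1.
    split=> U HU Uc.
      by have [n [_ Un]] := Hc1 U HU Uc 0%nat; exists (a n); split=> //; exists n.
    have [|n [_ Un]] := Hc2 _ (open_mulr (inv c2 ** c1) U HU) _ 0%nat.
      by gsimp.
    by exists (b n); split=> //; exists n.
  exists V'; split=> //.
  (* The translate of [core V'] by [c1] stays in the common closure, hence in the compact set
     containing all [a n]. *)
  apply: (compact_closed_subset T _ _ (compact_mull _ c1 HK') (core_closed V' HV')).
  move=> g Vg; have [Ag _] := HF c1 g Fc1 Vg.
  apply: (closure_min T _ _ _ (compact_closed _ HK') _ Ag).
  by move=> y [n <-]; exact: Kx.
Qed.

(** * Convergent sequences in compact groups *)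

Definition subgroup (N : G -> Prop) : Prop :=
  N e /\ (forall x y, N x -> N y -> N (x ** y)) /\ (forall x, N x -> N (inv x)).

(** For a compact subgroup [N] this is convergence of [x n] to the base point in the space of left
    cosets; for the trivial subgroup it is convergence to [e]. *)
Definition tends (N : G -> Prop) (x : nat -> G) : Prop :=
  forall W, is_open T W -> (forall g, N g -> W g) ->
    exists m, forall n, (m <= n)%nat -> forall g, N g -> W (x n ** g).

Lemma core_subgroup V : chain V -> subgroup (core V).
Proof.
  move=> HV; split; first exact: core1.
  by split=> [x y|x]; [exact: coreM|exact: coreV].
Qed.

Lemma subgroup_inter N M : subgroup N -> subgroup M -> subgroup (fun x => N x /\ M x).
Proof. by move=> [N1 [NM NV]] [M1 [MM MV]]; do 2?split; firstorder. Qed.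

(** The tube lemma for multiplication: the sets [S] in place of [C] for which one neighbourhood of
    [g] suffices form an ideal. *)
Lemma open_tube C W : compact_subset T C -> is_open T W ->
  is_open T (fun g => forall h, C h -> W (g ** h)).
Proof.
  move=> HC HW; apply: open_of_nbhds => g Hg.
  pose P (S : G -> Prop) := exists O, is_open T O /\ O g /\
    forall z, O z -> forall h, S h -> W (z ** h).
  apply: (compact_ind T C P HC).
  - by exists (fun _ => True); split; [exact: open_full|split=> // z _ h []].
  - move=> S S' SS' [O [HO [Og H]]]; exists O; split=> //; split=> // z Oz h /SS'.
    exact: H.
  - move=> S S' [O [HO [Og H]]] [O' [HO' [Og' H']]].
    exists (fun z => O z /\ O' z); split; first exact: open_inter.
    by split=> // z [Oz Oz'] h [Sh|Sh]; [exact: H|exact: H'].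
  - move=> h /Hg Wgh.
    have [U [V [HU [HV [Ug [Vh HUV]]]]]] := proj1 Htop _ _ _ HW Wgh.
    exists V; split=> //; split=> //; exists U; split=> //; split=> // z Uz k Vk.
    exact: HUV.
Qed.

Lemma tends_inter_core N V x y :
  subgroup N -> compact_subset T N -> chain V -> tends N x ->
  (forall n, N (inv (x n) ** y n)) ->
  (forall k, exists m, forall n, (m <= n)%nat -> V k (y n)) ->
  tends (fun g => N g /\ core V g) y.
Proof.
  move=> HN NK HV Hx xy Vy W HW NW.
  pose N' g := N g /\ core V g.
  have HN' : subgroup N' by apply: subgroup_inter => //; exact: core_subgroup.
  have N'K : compact_subset T N'.
    apply: (compact_closed_subset T N _ NK) => [|g [] //].
    apply: (open_ext T (fun g => ~ N g \/ ~ core V g)); first by move=> g; rewrite /N'; tauto.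
    by apply: open_or; [exact: compact_closed|exact: core_closed].
  pose W' g := forall h, N' h -> W (g ** h).
  have HW' : is_open T W' by exact: open_tube.
  have N'W' g : N' g -> W' g.
    by move=> Ng h Nh; apply: NW; case: HN' => _ [NM _]; exact: NM.
  (* [W'] covers the points of [N] in [core V], and any other point has a neighbourhood missing some
     [V k]. Compactness yields an open set around [N] whose part in one [V k] lies in [W']. *)
  pose P (S : G -> Prop) := exists O k, is_open T O /\ (forall z, S z -> O z) /\
    forall z, O z -> V k z -> W' z.
  have [] : P N; last first.
  - move=> O [k [HO [NO OW]]].
    have [m Hm] := Hx O HO NO; have [m' Hm'] := Vy k.
    exists (m + m')%nat => n Hn g Ng; apply: (OW (y n)) => //.
      have -> : y n = x n ** (inv (x n) ** y n) by gsimp.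
      by apply: Hm => //; lia.
    by apply: Hm'; lia.
  - apply: (compact_ind T N P NK).
    + by exists (fun _ => False), 0%nat; split; [exact: open_const|].
    + move=> S S' SS' [O [k [HO [SO OW]]]]; exists O, k; split=> //; split=> // z /SS'.
      exact: SO.
    + move=> S S' [O [k [HO [SO OW]]]] [O' [k' [HO' [SO' OW']]]].
      exists (fun z => O z \/ O' z), (k + k')%nat; split; first exact: open_or.
      split; first by move=> z [/SO|/SO']; [left|right].
      move=> z [Oz|Oz] Vz.
        by apply: OW => //; apply: (chain_le V HV _ (k + k')%nat) => //; lia.
      by apply: OW' => //; apply: (chain_le V HV _ (k + k')%nat) => //; lia.
    + move=> z Nz; have [Vz|/(core_avoid V z HV)] := classic (core V z).
        exists W'; split=> //; split; first exact: N'W'.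
        by exists W', 0%nat.
      move=> [k [O [HO [Oz H]]]]; exists O; split=> //; split=> //.
      by exists O, k; split=> //; split=> // u /H.
Qed.

Lemma tends_lift N V x : subgroup N -> chain V -> tends N x ->
  exists y, (forall n, N (inv (x n) ** y n)) /\
    forall k, exists m, forall n, (m <= n)%nat -> V k (y n).
Proof.
  move=> [N1 [NM NV]] HV Hx.
  pose W k z := exists g, N g /\ V k (z ** g).
  have HW k : is_open T (W k).
    apply: open_of_nbhds => z [g [Ng Vg]].
    exists (fun z => V k (z ** g)); split; first by apply: open_mulr; case: HV.
    by split=> // u Vu; exists g.
  have Wx k : exists m, forall n, (m <= n)%nat -> W k (x n).
    have [|m Hm] := Hx (W k) (HW k).
      move=> g Ng; exists (inv g); split; first exact: NV.
      by rewrite mulgV; case: HV => _ [].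
    by exists m => n /Hm /(_ e N1); rewrite mulg1.
  (* Among the indices up to [b], the last [k] for which [V k] meets the coset of [z] decides the
     choice, since the chain decreases. *)
  have pick z b : exists y, N (inv z ** y) /\ forall k, (k <= b)%nat -> W k z -> V k y.
    elim: b => [|b [y [Ny IH]]].
      have [[g [Ng Vg]]|nW] := classic (W 0%nat z).
        exists (z ** g); split; first by gsimp.
        by move=> k Hk _; have -> : k = 0%nat by lia.
      exists z; split; first by rewrite mulVg.
      by move=> k Hk; have -> : k = 0%nat by lia.
    have [[g [Ng Vg]]|nW] := classic (W (S b) z).
      exists (z ** g); split; first by gsimp.
      by move=> k Hk _; exact: (chain_le V HV _ (S b)).
    exists y; split=> // k Hk Wk; apply: IH => //.
    have [E|] : k = S b \/ (k <= b)%nat by lia.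
      by case: nW; rewrite -E.
    by [].
  have [y Hy] := choice _ (fun n => pick (x n) n).
  exists y; split; first by move=> n; case: (Hy n).
  move=> k; have [m Hm] := Wx k; exists (m + k)%nat => n Hn.
  by case: (Hy n) => _; apply; [lia|apply: Hm; lia].
Qed.

Definition coset_sequence (q : (G -> Prop) * (nat -> G)) : Prop :=
  subgroup (fst q) /\ compact_subset T (fst q) /\ tends (fst q) (snd q).

(** For subgroups, this says that each coset of [r] lies in the coset of [q] with the same index.
    Larger elements of this preorder thus have smaller subgroups. *)
Definition lifts (q r : (G -> Prop) * (nat -> G)) : Prop :=
  (forall g, fst r g -> fst q g) /\ forall n, fst q (inv (snd q n) ** snd r n).

Lemma lifts_coset q r n z : coset_sequence q -> lifts q r ->
  fst r (inv (snd r n) ** z) -> fst q (inv (snd q n) ** z).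
Proof.
  move=> [[_ [NM _]] _] [rq qr] /rq H.
  by have := NM _ _ (qr n) H; gsimp.
Qed.

Lemma lifts_refl q : coset_sequence q -> lifts q q.
Proof. by move=> [[N1 _] _]; split=> // n; rewrite mulVg. Qed.

Lemma lifts_trans q r s : coset_sequence q -> lifts q r -> lifts r s -> lifts q s.
Proof.
  move=> Hq qr [sr rs]; split; first by move=> g /sr; case: qr => H _; exact: H.
  by move=> n; apply: (lifts_coset q r).
Qed.

(** The upper bound for Zorn's lemma: the intersection of the subgroups, with one point from each
    intersection of nested compact cosets. *)
Lemma lifts_chain (A : (G -> Prop) * (nat -> G) -> Prop) q0 :
  (forall q, A q -> coset_sequence q) -> A q0 ->
  (forall q r, A q -> A r -> lifts q r \/ lifts r q) ->
  exists s, coset_sequence s /\ forall q, A q -> lifts q s.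
Proof.
  move=> HA A0 Atot.
  have [_ [K0 _]] := HA _ A0.
  pose N g := forall q, A q -> fst q g.
  have [y Hy] : exists y : nat -> G, forall n q, A q -> fst q (inv (snd q n) ** y n).
    apply: (choice (fun n z => forall q, A q -> fst q (inv (snd q n) ** z))) => n.
    apply: NNPP => Hno.
    (* If the cosets had empty intersection, compactness would give a single coset disjoint from
       that of [q0], against nestedness. *)
    pose P (S : G -> Prop) := exists q, A q /\
      forall g, S g -> ~ fst q (inv (snd q n) ** (snd q0 n ** g)).
    have [] : P (fst q0); last first.
    - move=> q [Aq Hq]; have [[N01 _] _] := HA _ A0; have [[Nq1 _] _] := HA _ Aq.
      have [[_ H]|[_ H]] := Atot q0 q A0 Aq.
        by apply: (Hq _ (H n)); gsimp.
      by apply: (Hq _ N01); rewrite mulg1.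
    - apply: (compact_ind T (fst q0) P K0).
      + by exists q0.
      + by move=> S S' SS' [q [Aq Hq]]; exists q; split=> // g /SS'; exact: Hq.
      + move=> S S' [q [Aq Hq]] [r [Ar Hr]].
        have [qr|rq] := Atot q r Aq Ar.
          exists r; split=> // g [Sg|Sg]; last exact: Hr.
          by move=> H; apply: (Hq g Sg); apply: (lifts_coset q r) => //; exact: HA.
        exists q; split=> // g [Sg|Sg]; first exact: Hq.
        by move=> H; apply: (Hr g Sg); apply: (lifts_coset r q) => //; exact: HA.
      + move=> g _; have [q Hq] : exists q, A q /\
            ~ fst q (inv (snd q n) ** (snd q0 n ** g)).
          apply: NNPP => Hq; apply: Hno; exists (snd q0 n ** g) => q Aq.
          by apply: NNPP => H; apply: Hq; exists q.
        case: Hq => Aq Hq; have [_ [Kq _]] := HA _ Aq.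
        exists (fun h => ~ fst q (inv (snd q n) ** (snd q0 n ** h))); split.
          apply: (open_mull (snd q0 n) (fun h => ~ fst q (inv (snd q n) ** h))).
          by apply: (open_mull _ (fun h => ~ fst q h)); exact: compact_closed.
        by split=> //; exists q.
  have HN : subgroup N.
    split; first by move=> q /HA [[]].
    split; first by move=> g h Ng Nh q Aq; have [[_ [NM _]] _] := HA _ Aq; apply: NM; auto.
    by move=> g Ng q Aq; have [[_ [_ NV]] _] := HA _ Aq; apply: NV; auto.
  exists (N, y); split; last by move=> q Aq; split=> [g|n] /=; [apply|exact: Hy].
  split=> //; split=> /=.
  - apply: (compact_closed_subset T _ _ K0); last by move=> g; apply.
    apply: open_of_nbhds => g nNg.
    have [q Hq] := not_all_ex_not _ _ nNg; have [Aq {}Hq] := imply_to_and _ _ Hq.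
    have [_ [Kq _]] := HA _ Aq.
    exists (fun h => ~ fst q h); split; first exact: compact_closed.
    by split=> // h nqh /(_ q Aq).
  - move=> W HW NW.
    (* By compactness some subgroup of the family already lies in [W]; its own convergence then
       controls [y]. *)
    pose P (S : G -> Prop) := exists q, A q /\ forall g, S g -> fst q g -> W g.
    have [q [Aq Hq]] : P (fst q0).
      apply: (compact_ind T (fst q0) P K0).
      + by exists q0.
      + by move=> S S' SS' [q [Aq Hq]]; exists q; split=> // g /SS'; exact: Hq.
      + move=> S S' [q [Aq Hq]] [r [Ar Hr]].
        have [[qr _]|[rq _]] := Atot q r Aq Ar.
          by exists r; split=> // g [Sg|Sg] rg; [apply: Hq => //; exact: qr|exact: Hr].
        by exists q; split=> // g [Sg|Sg] qg; [exact: Hq|apply: Hr => //; exact: rq].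
      + move=> g _; have [Wg|nWg] := classic (W g).
          by exists W; split=> //; split=> //; exists q0.
        have [q Hq] : exists q, A q /\ ~ fst q g.
          apply: NNPP => Hq; apply: nWg; apply: NW => q Aq.
          by apply: NNPP => H; apply: Hq; exists q.
        case: Hq => Aq Hq; have [_ [Kq _]] := HA _ Aq.
        exists (fun h => ~ fst q h); split; first exact: compact_closed.
        by split=> //; exists q.
    have [r [Ar rW]] : exists r, A r /\ forall g, fst r g -> W g.
      have [[H _]|[H _]] := Atot q0 q A0 Aq.
        by exists q; split=> // g qg; apply: Hq => //; exact: H.
      by exists q0; split=> // g qg; apply: Hq => //; exact: H.
    have [_ [_ rt]] := HA _ Ar; have [m Hm] := rt W HW rW.
    exists m => n Hn g Ng.
    have -> : y n ** g = snd r n ** (inv (snd r n) ** y n ** g) by gsimp.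
    apply: Hm => //; have [[_ [NM _]] _] := HA _ Ar.
    by apply: NM; [exact: Hy|exact: Ng].
Qed.

(* A minimal subgroup to which the sequence of cosets lifts is trivial. *)
Lemma lift_to_identity q0 : coset_sequence q0 ->
  exists x : nat -> G, (forall n, fst q0 (inv (snd q0 n) ** x n)) /\
    forall W, is_open T W -> W e -> exists m, forall n, (m <= n)%nat -> W (x n).
Proof.
  move=> H0.
  pose D := {q | coset_sequence q /\ lifts q0 q}.
  pose R (q r : D) := boolp.asbool (lifts (proj1_sig q) (proj1_sig r)).
  have [|||[[N x] /= [Hq0 q0q]] qmax] :=
    @classical_sets.ZL_preorder D (exist _ q0 (conj H0 (lifts_refl q0 H0))) R.
  - by move=> [q [Hq q0q]]; apply/boolp.asboolP; exact: lifts_refl.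
  - move=> [r [Hr ?]] [q [Hq ?]] [s [Hs ?]] /boolp.asboolP /= qr /boolp.asboolP /= rs.
    by apply/boolp.asboolP; exact: (lifts_trans r q s).
  - move=> A Atot.
    have [[t At]|nA] := classic (exists t, A t); last first.
      (* The empty chain is bounded by [q0] itself. *)
      exists (exist _ q0 (conj H0 (lifts_refl q0 H0))) => s As.
      by case: nA; exists s.
    have [|||s [Hs As]] := lifts_chain (fun q => exists t, A t /\ proj1_sig t = q) (proj1_sig t).
    + by move=> q [u [_ <-]]; case: (proj2_sig u).
    + by exists t.
    + move=> q r [u [Au <-]] [v [Av <-]].
      by have [/boolp.asboolP H|/boolp.asboolP H] := Atot u v Au Av; [left|right].
    have Hs0 : coset_sequence s /\ lifts q0 s.
      split=> //; apply: (lifts_trans q0 (proj1_sig t)) => //.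
        by case: (proj2_sig t).
      by apply: As; exists t.
    exists (exist _ s Hs0) => u Au; apply/boolp.asboolP; apply: As.
    by exists u.
  have [HN [KN Nx]] := Hq0.
  (* Otherwise [N] is cut down by a core missing [g] and the sequence is lifted; maximality would
     put [g] into that core. *)
  have Ne g : N g -> g = e.
    move=> Ng; apply: NNPP => /chain_separating_point [V [HV Vg]].
    have [y [xy Vy]] := tends_lift N V x HN HV Nx.
    pose q' : (G -> Prop) * (nat -> G) := (fun g => N g /\ core V g, y).
    have Hq' : coset_sequence q'.
      split; first by apply: subgroup_inter => //; exact: core_subgroup.
      split; last exact: (tends_inter_core N V x).
      apply: (compact_closed_subset T N _ KN) => [|h [] //].
      apply: (open_ext T (fun g => ~ N g \/ ~ core V g)); first by move=> h /=; tauto.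
      by apply: open_or; [exact: compact_closed|exact: core_closed].
    have qq' : lifts (N, x) q' by split=> [h [] //|].
    have q0q' := lifts_trans _ _ _ H0 q0q qq'.
    have /boolp.asboolP /= [/(_ g Ng) [_ cg] _] :=
      qmax (exist _ q' (conj Hq' q0q')) (introT (boolp.asboolP _) qq').
    exact: (Vg (cg 0%nat)).
  exists x; split; first exact: (proj2 q0q).
  move=> W HW We; have [|m Hm] := Nx W HW; first by move=> g /Ne ->.
  exists m => n /Hm /(_ e); rewrite mulg1; apply; exact: (proj1 HN).
Qed.

(** A compact core that is finite is refined by separating its points. An infinite one contains a
    sequence of distinct terms tending to [e], whose even and odd halves have only [e] in both
    closures; the stabilizing core is then trivial. *)
Lemma identity_gdelta (Hhn : hereditarily_normal T) K (k : nat -> G) :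
  compact_subset T K -> (forall n, K (k n)) -> (forall n m, k n = k m -> n = m) ->
  exists V, chain V /\ forall g, core V g -> g = e.
Proof.
  move=> HK Kk inj.
  have [V0 [HV0 KV0]] := compact_gdelta_subgroup Hhn K k HK Kk inj.
  have HS := core_subgroup V0 HV0; have [S1 [SM SV]] := HS.
  have [[l Hl]|Hinf] := classic (exists l, forall x, core V0 x -> In x l).
    have [V [HV Vsep]] := chain_separating (fun n => nth n l e).
    have [U [HU UV]] := chain_inter V0 V HV0 HV.
    exists U; split=> // g Ug.
    have V0g : core V0 g by move=> n; case: (UV n g (Ug n)).
    have Vg : core V g by move=> n; case: (UV n g (Ug n)).
    have [i [_ Hi]] := In_nth l g e (Hl _ V0g).
    have [j [_ Hj]] := In_nth l e e (Hl _ S1).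
    by have := Vsep j i; rewrite Hi Hj inv1 mul1g => ->.
  have [a [Va ainj]] := infinite_injection _ Hinf.
  have [V [p [x [HV [Kp [Kx [Vx [nVx xsep]]]]]]]] := spread_sequence _ a KV0 Va ainj.
  have V0x n : core V0 (x n).
    by have := SM _ _ (SV _ Kp) (Kx n); gsimp.
  pose N g := core V0 g /\ core V g.
  have HN : coset_sequence (N, x).
    split; first by apply: subgroup_inter => //; exact: core_subgroup.
    split=> /=.
      apply: (compact_closed_subset T _ _ KV0) => [|h [] //].
      apply: (open_ext T (fun g => ~ core V0 g \/ ~ core V g)); first by move=> g; rewrite /N; tauto.
      by apply: open_or; exact: core_closed.
    apply: (tends_inter_core (core V0) V x) => //.
    (* The terms already lie in [core V0], so their cosets modulo it are constant. *)
    - by move=> W HW V0W; exists 0%nat => n _ g V0g; apply: V0W; exact: SM.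
    - by move=> n; rewrite mulVg.
    - by move=> i; exists i => n Hn; apply: (chain_le V HV _ n).
  have [z [/= xz ze]] := lift_to_identity _ HN.
  have Vxz n : core V (inv (x n) ** z n) by case: (xz n).
  have zsep n m : z n = z m -> n = m.
    move=> E; apply: xsep.
    have := coreM V _ _ HV (Vxz n) (coreV V _ HV (Vxz m)).
    by rewrite E; gsimp.
  have zne n : z n <> e.
    move=> E; apply: (nVx n); have := coreV V _ HV (Vxz n).
    by rewrite E; gsimp.
  have away (s : nat -> nat) f : (forall n, (n <= s n)%nat) -> f <> e ->
      closure T (fun y => exists n, z (s n) = y) f -> exists n, z (s n) = f.
    move=> Hs fe Hf; apply: (closure_range (fun n => z (s n))) => //.
    have [O [O' [HO [HO' [Of [O'e OO']]]]]] := hausdorff f e fe.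
    have [m Hm] := ze O' HO' O'e; exists O, m; split=> //; split=> // n Hn On.
    by apply: (OO' _ On); apply: Hm; have := Hs n; lia.
  have clz (s : nat -> nat) : (forall n, (n <= s n)%nat) ->
      closure T (fun y => exists n, z (s n) = y) e.
    move=> Hs U HU Ue; have [m Hm] := ze U HU Ue; exists (z (s m)).
    by split; [apply: Hm|exists m].
  have even n : (n <= 2 * n)%nat by lia.
  have odd n : (n <= 2 * n + 1)%nat by lia.
  have Fe f : closure T (fun y => exists n, z (2 * n)%nat = y) f /\
      closure T (fun y => exists n, z (2 * n + 1)%nat = y) f -> f = e.
    move=> [/(away _ _ even) Hev /(away _ _ odd) Hod]; apply: NNPP => fe.
    have [n Hn] := Hev fe; have [m Hm] := Hod fe.
    have : (2 * n = 2 * m + 1)%nat by apply: zsep; rewrite Hn Hm.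
    by lia.
  have [||V' [HV' HF]] := common_closure_stabilizer Hhn
    (fun n => z (2 * n)%nat) (fun n => z (2 * n + 1)%nat).
  - by move=> n /Fe; exact: zne.
  - by move=> n /Fe; exact: zne.
  exists V'; split=> // g Vg.
  rewrite -(mul1g g); apply: Fe; apply: HF => //.
  by split; apply: clz.
Qed.

(** * Metrization *)

Fixpoint word (U : nat -> G -> Prop) (s : list nat) (g : G) : Prop :=
  match s with
  | nil => g = e
  | k :: s' => exists a b, U k a /\ word U s' b /\ g = a ** b
  end.

Lemma word_app U s t g h : word U s g -> word U t h -> word U (s ++ t) (g ** h).
Proof.
  elim: s g => [|k s IH] g /=; first by move=> ->; rewrite mul1g.
  move=> [a [b [Ua [Wb ->]]]] Wh; exists a, (b ** h); split=> //.
  by split; [exact: IH|gsimp].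
Qed.

Lemma word_app_inv U s t g : word U (s ++ t) g ->
  exists a b, word U s a /\ word U t b /\ g = a ** b.
Proof.
  elim: s g => [|k s IH] g /=; first by exists e, g; rewrite mul1g.
  move=> [a [b [Ua [/IH [c [d [Wc [Wd ->]]]] ->]]]].
  exists (a ** c), d; split; first by exists a, c.
  by split=> //; gsimp.
Qed.

Lemma word_rev U s g : (forall k x, U k x -> U k (inv x)) ->
  word U s g -> word U (rev s) (inv g).
Proof.
  move=> UV; elim: s g => [|k s IH] g /=; first by move=> ->; exact: inv1.
  move=> [a [b [Ua [/IH Wb ->]]]]; rewrite invM; apply: word_app => //.
  exists (inv a), e; split; first exact: UV.
  by rewrite mulg1.
Qed.

(* Splitting the word at half its weight leaves two factors of less than half
   the weight around a single letter. *)
Lemma word_small (U : nat -> G -> Prop) :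
  (forall k, U k e) ->
  (forall k x y z, U (S k) x -> U (S k) y -> U (S k) z -> U k (x ** y ** z)) ->
  forall s k g, word U s g -> weight s < (/ 2) ^ k -> U k g.
Proof.
  move=> U1 U3.
  have Ule m n x : (m <= n)%nat -> U n x -> U m x.
    elim: n => [|n IH] Hmn Ux; first by (have -> : m = 0%nat by lia).
    have [->//|Hmn'] : m = S n \/ (m <= n)%nat by lia.
    by apply: IH => //; rewrite -(mulg1 x) -(mulg1 (x ** e)); exact: U3.
  (* The induction is on a bound for the length, because the prefix [l] is not a tail of the
     word. *)
  suff H n s k g : (length s <= n)%nat -> word U s g -> weight s < (/ 2) ^ k -> U k g.
    by move=> s k g; apply: (H (length s)).
  elim: n s k g => [|n IH] s k g.
    by case: s => [|j s] /= Hn; [move=> ->|lia].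
  move=> Hn Wg Hk; have [Ws|Ws] := Rle_lt_or_eq_dec _ _ (weight_ge0 s); last first.
    case: s Hn Wg Hk Ws => [|j s] /= Hn; first by move=> -> _ _; exact: U1.
    by have := half_pow_gt0 j; have := weight_ge0 s; lra.
  have [||l [j [r [E [Hl Hr]]]]] := weight_split s (weight s / 2); try lra.
  move: Wg Hn; rewrite E => /word_app_inv [a [h [Wa [/= [b [c [Ub [Wc ->]]]] ->]]]].
  rewrite length_app /= => Hn.
  have Es : weight s = weight l + ((/ 2) ^ j + weight r) by rewrite E weight_app.
  have := weight_ge0 l; have := weight_ge0 r => r0 l0.
  (* The middle letter weighs at most [weight s], which is below [(/ 2) ^ k]. *)
  have Hj : (S k <= j)%nat.
    have [//|Hj] : (S k <= j \/ j <= k)%nat by lia.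
    by have := half_pow_le _ _ Hj; lra.
  rewrite mulA; apply: U3; [|exact: (Ule _ j)|].
  - by apply: (IH l) => //=; [lia|lra].
  - by apply: (IH r) => //=; [lia|lra].
Qed.

(** The Birkhoff-Kakutani norm: the infimum of the weights of all words representing the element. *)
Lemma chain_norm V : chain V ->
  exists N : G -> R, (forall g, 0 <= N g) /\ N e = 0 /\
    (forall g, N (inv g) = N g) /\ (forall g h, N (g ** h) <= N g + N h) /\
    (forall k, exists m, forall g, V m g -> N g <= (/ 2) ^ k) /\
    (forall k, exists r, 0 < r /\ forall g, N g < r -> V k g).
Proof.
  move=> HV; case: (HV) => [_ [V1 [VV VM]]].
  (* Skipping every other term turns the condition on products of two into one on products of three.
     [U 0] is everything, so each element has a one-letter word. *)
  pose U k g := match k with 0%nat => True | S k' => V (2 * k')%nat g end.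
  have U1 k : U k e by case: k => [|k] /=.
  have UV k x : U k x -> U k (inv x) by case: k => [|k] //=; exact: VV.
  have U3 k x y z : U (S k) x -> U (S k) y -> U (S k) z -> U k (x ** y ** z).
    case: k => [|k] // Ux Uy Uz; rewrite /U.
    have E : (2 * S k = S (S (2 * k)))%nat by lia.
    move: Ux Uy Uz; rewrite /U E => Ux Uy Uz; apply: (VM); first exact: (VM).
    by apply: (chain_le V HV _ (S (S (2 * k)))) => //; lia.
  have [N HN] : exists N : G -> R, forall g, (forall s, word U s g -> N g <= weight s) /\
      forall r, N g < r -> exists s, word U s g /\ weight s < r.
    apply: (choice (fun g m => (forall s, word U s g -> m <= weight s) /\
      forall r, m < r -> exists s, word U s g /\ weight s < r)) => g.
    (* Negated weights turn the infimum into a supremum, to which completeness applies. *)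
    pose E r := exists s, word U s g /\ r = - weight s.
    have [||m [ub lub]] := completeness E.
    - by exists 0 => _ [s [_ ->]]; have := weight_ge0 s; lra.
    - by exists (- weight (0%nat :: nil)), (0%nat :: nil); split=> //; exists g, e; rewrite mulg1.
    - exists (- m); split.
        move=> s Ws; have Es : E (- weight s) by exists s.
        by have := ub _ Es; lra.
      move=> r Hr; apply: NNPP => Hno.
      have : m <= - r; last by lra.
      apply: lub => _ [s [Ws ->]].
      have [Hs|Hs] := Rlt_le_dec (weight s) r; last by lra.
      by case: Hno; exists s.
  have Nge0 g : 0 <= N g.
    have [//|Hlt] := Rle_lt_dec 0 (N g).
    by have [s [_ Hs]] := proj2 (HN g) 0 Hlt; have := weight_ge0 s; lra.
  have NVle g : N (inv g) <= N g.
    apply: Rnot_lt_le => /(proj2 (HN g)) [s [Ws Hs]].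
    have := proj1 (HN (inv g)) _ (word_rev U s g UV Ws).
    by rewrite weight_rev; lra.
  have small k g : N g < (/ 2) ^ k -> U k g.
    by move=> /(proj2 (HN g)) [s [Ws Hs]]; exact: (word_small U U1 U3 s).
  exists N; split=> //; split.
    by apply: Rle_antisym => //; apply: (proj1 (HN e) nil).
  split.
    by move=> g; apply: Rle_antisym => //; have := NVle (inv g); rewrite invK.
  split.
    move=> g h; apply: Rnot_lt_le => Hlt.
    pose d := (N (g ** h) - (N g + N h)) / 2.
    have [|s [Ws Hs]] := proj2 (HN g) (N g + d); first by rewrite /d; lra.
    have [|t [Wt Ht]] := proj2 (HN h) (N h + d); first by rewrite /d; lra.
    have := proj1 (HN (g ** h)) _ (word_app U s t g h Ws Wt).
    by move: Hs Ht; rewrite weight_app /d; lra.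
  split.
    move=> k; exists (2 * k)%nat => g Vg.
    have := proj1 (HN g) (S k :: nil); have := half_pow_gt0 k => /= H0 H.
    suff : N g <= / 2 * (/ 2) ^ k + 0 by lra.
    by apply: H; exists g, e; rewrite mulg1.
  move=> k; exists ((/ 2) ^ (S k)); split; first exact: half_pow_gt0.
  by move=> g /small /= Vg; apply: (chain_le V HV _ (2 * k)%nat) => //; lia.
Qed.

(** The norm of [inv x ** y] is a left-invariant pseudometric on [G], and a metric on [K] because
    the core separates its points. Its balls are neighbourhoods, and compactness of [K] gives the
    converse comparison. *)
Lemma compact_metrizable K V :
  compact_subset T K -> chain V ->
  (forall x y, K x -> K y -> core V (inv x ** y) -> x = y) ->
  metrizable (subspace T K).
Proof.
  move=> HK HV Vsep; case: (HV) => [Vo [V1 [VV VM]]].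
  have [N [N0 [N1 [NV [NM [NU UN]]]]]] := chain_norm V HV.
  exists (fun p q => N (inv (proj1_sig p) ** proj1_sig q)); split.
    split; first by move=> p q; exact: N0.
    split.
      move=> [x Kx] [y Ky] /=; split; last by case=> ->; rewrite mulVg.
      move=> E; have xy : x = y.
        apply: Vsep => // k; have [r [r0 Hr]] := UN k.
        by apply: Hr; rewrite E.
      by subst y; rewrite (proof_irrelevance _ Kx Ky).
    split; first by move=> p q; rewrite -NV invM invK.
    move=> p q r.
    have := NM (inv (proj1_sig p) ** proj1_sig q) (inv (proj1_sig q) ** proj1_sig r).
    by gsimp.
  move=> W; split.
  - move=> [O [HO OW]] [x Kx] /OW /= Ox.
    (* One index [k] has to exclude all points of [K] outside [O] from the translate of [V k] to
       [x]. *)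
    pose P (S : G -> Prop) := exists k, forall y, S y -> K y -> ~ O y -> ~ V k (inv x ** y).
    have [k Hk] : P K.
      apply: (compact_ind T K P HK).
      + by exists 0%nat.
      + by move=> S S' SS' [k Hk]; exists k => y /SS'; exact: Hk.
      + move=> S S' [k Hk] [k' Hk']; exists (k + k')%nat => y [Sy|Sy] Ky nOy Vy.
          by apply: (Hk y) => //; apply: (chain_le V HV _ (k + k')%nat) => //; lia.
        by apply: (Hk' y) => //; apply: (chain_le V HV _ (k + k')%nat) => //; lia.
      + move=> y Ky; have [Oy|nOy] := classic (O y).
          by exists O; split=> //; split=> //; exists 0%nat.
        have nV : ~ core V (inv x ** y).
          by move=> /(Vsep x y Kx Ky) E; apply: nOy; rewrite -E.
        have [k [Q [HQ [Qy H]]]] := core_avoid V _ HV nV.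
        exists (fun y => Q (inv x ** y)); split; first exact: open_mull.
        by split=> //; exists k => z Qz _ _; exact: H.
    have [r [r0 Hr]] := UN k; exists r; split=> // [[y Ky]] /= /Hr Vy.
    by apply/OW => /=; apply: NNPP => nOy; exact: (Hk y).
  - move=> HW.
    exists (fun z => exists O, (is_open T O /\ forall p : {x | K x}, O (proj1_sig p) -> W p) /\ O z).
    split; first by apply: open_union => O [].
    move=> [x Kx] /=; split; last by move=> [O [[_ H] Ox]]; exact: H.
    move=> /HW [r [r0 Hr]].
    have [k Hk] : exists k, (/ 2) ^ k < r.
      have [|k Hk] := pow_lt_1_zero (/ 2) _ r r0.
        by rewrite Rabs_pos_eq; lra.
      exists k; have := Hk k (Nat.le_refl k).
      by rewrite Rabs_pos_eq //; have := half_pow_gt0 k; lra.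
    have [m Hm] := NU k.
    exists (fun z => V m (inv x ** z)); split; last by rewrite mulVg.
    split; first exact: open_mull.
    by move=> p Vp; apply: Hr => /=; have := Hm _ Vp; lra.
Qed.

End TopologicalGroup.

Theorem theorem2p9 (G : Type) (T : Topology G)
  (mul : G -> G -> G) (inv : G -> G) (e : G)
  (Hgrp : is_group mul inv e) (Htop : topological_group T mul inv)
  (HT1 : T1_space T) (Hhn : hereditarily_normal T)
  (K : G -> Prop) (HK : compact_subset T K) :
  metrizable (subspace T K).
Proof.
  (* For finite [K], a chain separating the listed points suffices; [e] is only the default of
     [nth]. Otherwise an injective sequence in [K] leads to a chain with trivial core. *)
  have [[l Hl]|Hinf] := classic (exists l, forall x, K x -> In x l).
  - have [V [HV Vsep]] := chain_separating T mul inv e Hgrp Htop HT1 (fun n => nth n l e).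
    apply: (compact_metrizable T mul inv e Hgrp Htop K V HK HV) => x y Kx Ky.
    have [i [_ <-]] := In_nth l x e (Hl x Kx).
    have [j [_ <-]] := In_nth l y e (Hl y Ky).
    exact: Vsep.
  - have [a [Ka inj]] := infinite_injection K Hinf.
    have [V [HV Ve]] := identity_gdelta T mul inv e Hgrp Htop HT1 Hhn K a HK Ka inj.
    apply: (compact_metrizable T mul inv e Hgrp Htop K V HK HV) => x y _ _ /Ve.
    exact: (eq_of_mulV mul inv e Hgrp).
Qed.
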